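(* Let $n\ge 2$, and let $T=(T_1,\ldots,T_n)$ be a $\mathcal{U}_n$-twisted isometry on a complex Hilbert space $\mathcal{H}$. Then there exist $2^n$ closed subspaces $\{\mathcal{H}_\Lambda:\Lambda\subseteq I_n\}$ of $\mathcal{H}$ (counting the trivial subspace $\{0\}$), each reducing all of $T_1,\ldots,T_n$, such that $$\mathcal{H}=\bigoplus_{\Lambda\subseteq I_n}\mathcal{H}_\Lambda\quad\text{(orthogonal direct sum)},$$ and for each $\Lambda\subseteq I_n$, $$\mathcal{H}_\Lambda=\bigoplus_{\mathbf{k}\in\mathbb{Z}_+^{\Lambda}}T_\Lambda^{\mathbf{k}}\bigg(\bigcap_{\mathbf{m}\in\mathbb{Z}_+^{I_n\setminus\Lambda}}T_{I_n\setminus\Lambda}^{\mathbf{m}}\,\mathcal{W}_\Lambda\bigg).$$ For each $\Lambda$ with $\mathcal{H}_\Lambda\ne\{0\}$ and each $i=1,\ldots,n$, $T_i|_{\mathcal{H}_\Lambda}$ is unitary if $i\in I_n\setminus\Lambda$ and is a shift if $i\in\Lambda$. Furthermore, this decomposition is unique: it is the only orthogonal decomposition of $\mathcal{H}$ into closed subspaces indexed by the subsets of $I_n$, each reducing all the $T_i$, with these unitary / shift properties.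
   Context: $\mathcal{H}$ is a complex Hilbert space, $\mathbb{Z}_+=\{0,1,2,\ldots\}$, $I_n=\{1,\ldots,n\}$. $\mathcal{R}(T)$ is the range and $\mathcal{N}(T)$ the kernel of $T$. A closed subspace $\mathcal{M}$ reduces $T$ if $T\mathcal{M}\subseteq\mathcal{M}$ and $T\mathcal{M}^\perp\subseteq\mathcal{M}^\perp$. A (unilateral) shift, of arbitrary multiplicity, is an isometry $V$ with $V^{*m}\to0$ strongly as $m\to\infty$ (equivalently, a completely non-unitary isometry). $\mathcal{U}_n$-twisted isometry ($n>1$): let $\{U_{ij}\}_{1\le i<j\le n}$ be $\binom n2$ commuting unitaries on $\mathcal{H}$ and put $U_{ji}:=U_{ij}^*$. An $n$-tuple of isometries $(T_1,\ldots,T_n)$ on $\mathcal{H}$ is a $\mathcal{U}_n$-twisted isometry with respect to the twist $\{U_{ij}\}_{i<j}$ if $$T_iT_j=U_{ij}T_jT_i,\qquad T_i^*T_j=U_{ij}^*T_jT_i^*,\qquad T_kU_{ij}=U_{ij}T_k$$ for all $i,j,k=1,\ldots,n$ with $i\neq j$. The phrase ''$\mathcal{U}_n$-twisted isometry'' means with respect to some such twist. For $\Lambda=\{i_1<i_2<\cdots<i_l\}\subseteq I_n$: $\mathbb{Z}_+^{\Lambda}=\{\mathbf{m}=(m_{i_1},\ldots,m_{i_l}):m_{i_j}\in\mathbb{Z}_+\}$ and $T_\Lambda^{\mathbf{m}}=T_{i_1}^{m_{i_1}}\cdots T_{i_l}^{m_{i_l}}$ (for $\Lambda=\emptyset$ the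 index set is a single point and $T_\emptyset^{\mathbf{m}}$ is the identity). Further, $\mathcal{W}_\Lambda=\mathcal{R}\big(\prod_{i\in\Lambda}(I-T_iT_i^* )\big)=\bigcap_{i\in\Lambda}\mathcal{N}(T_i^* )$ for nonempty $\Lambda$ (the projections $I-T_iT_i^*$ commute), and $\mathcal{W}_\emptyset=\mathcal{H}$. *)

(* Defs.v *)
From HB Require Import structures.
From mathcomp Require Import all_boot all_order all_algebra.
From mathcomp Require Import all_classical all_reals all_analysis.
From mathcomp Require Import complex.

Set Implicit Arguments.
Unset Strict Implicit.
Unset Printing Implicit Defensive.

Import Order.TTheory GRing.Theory Num.Theory.
Import numFieldNormedType.Exports.

Local Open Scope classical_set_scope.
Local Open Scope ring_scope.

(* A complex Hilbert space is a complete normed R[i]-module together with a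
   positive definite hermitian form (linear in its first argument) that induces
   the norm. *)
Definition hilbert_dot (R : realType) (H : completeNormedModType R[i])
    (dot : {dot H for (@Num.conj R[i])}) : Prop :=
  forall x : H, `|x| ^+ 2 = dot x x.

Section Subspaces.
Variables (R : realType) (H : completeNormedModType R[i]).
Variable dot : {dot H for (@Num.conj R[i])}.

Definition closed_subspace (M : set H) : Prop :=
  GRing.submod_closed [in M] /\ closed M.

Definition orth_compl (M : set H) : set H :=
  [set x | forall y, M y -> dot x y = 0].

(* The Hilbert space direct sum: [smallest closed_subspace] is the closed linear
   span. *)
Definition orth_dsum (I : Type) (F : I -> set H) (M : set H) : Prop :=
  [/\ forall i, closed_subspace (F i),
      forall i j, i <> j -> F i `<=` orth_compl (F j) &
      M = smallest closed_subspace (\bigcup_i F i)].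

(* For a closed subspace M invariant under a bounded operator A, the adjoint of
   the restriction A|_M, as an operator of the Hilbert space M. The chosen point
   is then the unique one by Riesz representation. *)
Definition adjoint_on (M : set H) (A : H -> H) : H -> H :=
  fun y => xget 0 [set z | M z /\ forall x, M x -> dot (A x) y = dot x z].

Definition adjoint (A : H -> H) : H -> H := adjoint_on setT A.

Definition isometry_on (M : set H) (A : H -> H) : Prop :=
  forall x, M x -> M (A x) /\ `|A x| = `|x|.

Definition unitary_on (M : set H) (A : H -> H) : Prop :=
  forall x, M x ->
    [/\ M (A x), adjoint_on M A (A x) = x & A (adjoint_on M A x) = x].

Definition shift_on (M : set H) (A : H -> H) : Prop :=
  isometry_on M A /\
  forall x, M x -> (fun m : nat => iter m (adjoint_on M A) x) @ \oo --> (0 : H).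

Definition reduces (M : set H) (A : H -> H) : Prop :=
  [/\ closed_subspace M, A @` M `<=` M & A @` orth_compl M `<=` orth_compl M].

End Subspaces.

Section TwistedIsometry.
Variables (R : realType) (H : completeNormedModType R[i]).
Variable dot : {dot H for (@Num.conj R[i])}.
Variables (n : nat) (T : 'I_n -> {linear H -> H}).

Local Notation "A ^*" := (adjoint dot A).

(* Only the values U i j with i < j are used: the others are replaced by
   U_ji := U_ij^*, and the diagonal is never consulted. *)
Definition twist (U : 'I_n -> 'I_n -> {linear H -> H}) (i j : 'I_n) : H -> H :=
  if (i < j)%N then (U i j : H -> H) else (U j i)^*.

Definition twisted_isometry_wrt (U : 'I_n -> 'I_n -> {linear H -> H}) : Prop :=
  [/\ forall i j : 'I_n, (i < j)%N -> unitary_on dot setT (U i j),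
      forall i j k l : 'I_n, (i < j)%N -> (k < l)%N ->
        U i j \o U k l =1 U k l \o U i j,
      forall i, isometry_on setT (T i) &
      forall i j : 'I_n, i != j ->
        [/\ T i \o T j =1 twist U i j \o T j \o T i,
            (T i)^* \o T j =1 (twist U i j)^* \o T j \o (T i)^* &
            forall k, T k \o twist U i j =1 twist U i j \o T k]].

Definition twisted_isometry : Prop :=
  exists U : 'I_n -> 'I_n -> {linear H -> H}, twisted_isometry_wrt U.

(* Z_+^L *)
Definition multi_index (L : {set 'I_n}) : Type :=
  {ffun {i : 'I_n | i \in L} -> nat}.

(* T_L^m; [enum] lists the indices in increasing order and the leftmost factor
   is applied last. *)
Definition tpow (L : {set 'I_n}) (m : multi_index L) : H -> H :=
  \big[comp/idfun]_(i <- enum {: {i : 'I_n | i \in L}}) iter (m i) (T (val i)).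

(* W_L, the range of the product of the I - T_i T_i^* for i in L *)
Definition wandering (L : {set 'I_n}) : set H :=
  range (\big[comp/idfun]_(i <- enum L) (fun x : H => x - T i ((T i)^* x))).

Definition wold_decomposition (HL : {set 'I_n} -> set H) : Prop :=
  [/\ forall L, closed_subspace (HL L),
      forall (L : {set 'I_n}) (i : 'I_n), reduces dot (HL L) (T i),
      orth_dsum dot HL setT &
      forall L, HL L <> [set 0] -> forall i,
        (i \notin L -> unitary_on dot (HL L) (T i)) /\
        (i \in L -> shift_on dot (HL L) (T i))].

End TwistedIsometry.

(* Main.v *)
Require Import Defs.
From HB Require Import structures.
From mathcomp Require Import all_boot all_order all_algebra.
From mathcomp Require Import all_classical all_reals all_analysis.
From mathcomp Require Import complex.
From mathcomp Require Import ring lra.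

Set Implicit Arguments.
Unset Strict Implicit.
Unset Printing Implicit Defensive.

Import Order.TTheory GRing.Theory Num.Theory.
Import numFieldNormedType.Exports.

Local Open Scope classical_set_scope.
Local Open Scope ring_scope.

(** Each isometry T_i has a Wold decomposition: the unitary part
    is the intersection of the ranges of the powers of T_i, the shift part its
    orthogonal complement. The twist enters through one fact only
    ([twisted_doubly_invariant_iter_range]): for i <> j, the range of every power
    of T_i is invariant under T_j and under its adjoint, because T_j and its
    adjoint commute with T_i up to a factor that commutes with T_i. Invariance
    under an operator and its adjoint passes to intersections and orthogonal
    complements, so the unitary part, the shift part and the wandering subspace
    ker T_i^* all reduce T_j.

    The part H_L is therefore defined as the intersection, over all i, of the
    shift part of T_i when i is in L and of the unitary part of T_i otherwise. It
    reduces every T_j, and two different parts are orthogonal because they differ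
    at some index. They span H because a subspace that reduces T_i splits along
    the Wold decomposition of T_i ([wold_split]), which can be applied to one
    index after the other ([wold_span]).

    Inside H_L, the intersection of the T_{L^c}^m W_L is the core
    W_L /\ (unitary parts of the T_i, i not in L), see [wold_coreE]. Its translates
    by T_L^k are orthogonal: if k_i < k'_i, the k-th translate is orthogonal to the
    range of T_i^{k_i + 1} while the k'-th lies in it. They span H_L since a
    nonzero q in H_L can be moved to a nonzero vector of the core by applying, for
    each i in L, some T_i^{*m} followed by the projection onto ker T_i^*; the
    adjoint of this operation sends that vector to a translate of the core which
    is not orthogonal to q ([prodT_detect]).

    Uniqueness: in another decomposition K, unitarity of T_i on K_L puts K_L into
    the unitary part of T_i, and strong convergence of T_i^{*m} to 0 makes K_L
    orthogonal to it. Hence K_L is contained in H_L for every L, and two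
    orthogonal decompositions of H, one contained in the other, are equal.

    The analysis needed is the existence of nearest points ([nearest_point]),
    which yields orthogonal projections, adjoints of isometries and the closedness
    of their ranges. *)

(** * Geometry of the inner product *)

Section HilbertGeometry.
Variables (R : realType) (H : completeNormedModType R[i]).
Variable dot : {dot H for (@Num.conj R[i])}.
Hypothesis dotE : hilbert_dot dot.

Implicit Types (x y z u v : H) (M N : set H) (e r : R).

(** The norm of H takes its values in R[i]; its real version lives in a totally
    ordered field, where infima and linear arithmetic are available. *)
Definition nrm x : R := complex.Re `|x|.

Lemma nrmE x : `|x| = (nrm x)%:C%C.
Proof. by rewrite /nrm RRe_real // normr_real. Qed.

Lemma nrm_ge0 x : 0 <= nrm x.
Proof. by rewrite -lecR -nrmE; exact: normr_ge0. Qed.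

Lemma nrmD x y : nrm (x + y) <= nrm x + nrm y.
Proof. by rewrite -lecR rmorphD /= -!nrmE ler_normD. Qed.

Lemma nrmZ (a : R[i]) x : (nrm (a *: x))%:C%C = `|a| * (nrm x)%:C%C.
Proof. by rewrite -!nrmE normrZ. Qed.

Lemma nrmN x : nrm (- x) = nrm x.
Proof. by rewrite /nrm normrN. Qed.

Lemma dotxx x : dot x x = (nrm x ^+ 2)%:C%C.
Proof. by rewrite -dotE nrmE rmorphXn. Qed.

Lemma dotDl x y z : dot (x + y) z = dot x z + dot y z.
Proof. by rewrite linearDl. Qed.
Lemma dotDr x y z : dot x (y + z) = dot x y + dot x z.
Proof. by rewrite linearDr. Qed.
Lemma dotBl x y z : dot (x - y) z = dot x z - dot y z.
Proof. by rewrite linearBl. Qed.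
Lemma dotBr x y z : dot x (y - z) = dot x y - dot x z.
Proof. by rewrite linearBr. Qed.
Lemma dotZl a x y : dot (a *: x) y = a * dot x y.
Proof. by rewrite linearZl_LR. Qed.
Lemma dotZr a x y : dot x (a *: y) = a^* * dot x y.
Proof. by rewrite linearZr_LR. Qed.
Lemma dot0l x : dot 0 x = 0.
Proof. by rewrite linear0l. Qed.
Lemma dot0r x : dot x 0 = 0.
Proof. by rewrite linear0r. Qed.
Lemma dotC x y : dot x y = (dot y x)^*.
Proof. by rewrite hermC expr0 mul1r. Qed.
Lemma dotC0 x y : dot x y = 0 -> dot y x = 0.
Proof. by move=> h; rewrite dotC h rmorph0. Qed.

Lemma dotxx0 x : dot x x = 0 -> x = 0.
Proof. by move/eqP; rewrite dnorm_eq0 => /eqP. Qed.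

Lemma eq_dot x y : (forall z, dot z x = dot z y) -> x = y.
Proof. by move=> h; apply/subr0_eq/dotxx0; rewrite dotBr h subrr. Qed.

Lemma parallelogram x y :
  nrm (x + y) ^+ 2 + nrm (x - y) ^+ 2 = 2 * (nrm x ^+ 2 + nrm y ^+ 2).
Proof.
apply: complexI; rewrite rmorphM !rmorphD /= -!dotxx.
rewrite !(dotBl, dotBr, dotDl, dotDr) (_ : 1%:C%C = 1) //; ring.
Qed.

(** The left side is the squared distance from x to the line of y: expanding it
    gives the Cauchy-Schwarz inequality and the variational argument of
    [nearest_point]. *)
Lemma dot_residual x y : y != 0 ->
  let w := x - (dot x y / dot y y) *: y in
  dot w w = dot x x - `|dot x y| ^+ 2 / dot y y.
Proof.
move=> y0 /=.
have yC : (dot y y)^* = dot y y by rewrite -dotC.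
rewrite !(dotBl, dotBr, dotZl, dotZr) (dotC y x) rmorphM fmorphV /= yC normCK.
by field; rewrite dnorm_eq0.
Qed.

Lemma cauchy_schwarz x y : `|dot x y| <= `|x| * `|y|.
Proof.
have [->|y0] := eqVneq y 0; first by rewrite dot0r !normr0 mulr0.
rewrite -(ler_pXn2r (ltn0Sn 1)) ?nnegrE ?mulr_ge0 //.
rewrite exprMn !dotE -ler_pdivrMr ?dnorm_gt0 // -subr_ge0 -dot_residual //.
Qed.

Lemma closed_approx M x : closed M ->
  (forall e, 0 < e -> exists2 z, M z & nrm (x - z) < e) -> M x.
Proof.
move=> /closure_id Mcl h; rewrite Mcl => B /nbhs_ballP[e /= e0 eB].
have eE : e = (complex.Re e)%:C%C by rewrite RRe_real // gtr0_real.
have /h[z Mz zx] : 0 < complex.Re e by rewrite -ltcR -eE.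
by exists z; split => //; apply: eB; rewrite -ball_normE /= eE nrmE ltcR.
Qed.

Lemma approx_closed M :
  (forall x, (forall e, 0 < e -> exists2 z, M z & nrm (x - z) < e) -> M x) ->
  closed M.
Proof.
move=> h x clx; apply: h => e e0.
have [|z []] := clx (ball x e%:C%C); first by apply: nbhsx_ballx; rewrite ltcR.
by rewrite -ball_normE /= nrmE ltcR => ? ?; exists z.
Qed.

End HilbertGeometry.

(** * Closed subspaces *)

Section ClosedSubspaces.
Variables (R : realType) (H : completeNormedModType R[i]).
Variable dot : {dot H for (@Num.conj R[i])}.
Hypothesis dotE : hilbert_dot dot.
Implicit Types (x y z u v : H) (M N : set H) (e r : R).

Lemma closed_subspaceP M : closed_subspace M <->
  [/\ M 0, forall a x y, M x -> M y -> M (a *: x + y) & closed M].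
Proof.
split=> [[[M0 Ml] Mc]|[M0 Ml Mc]].
  split=> //; first by move/set_mem: M0.
  by move=> a x y Mx My; apply/set_mem/Ml; apply/mem_set.
by split=> //; split=> [|a x y /set_mem Mx /set_mem My]; apply/mem_set; auto.
Qed.

Lemma closed_subspace0 M : closed_subspace M -> M 0.
Proof. by case/closed_subspaceP. Qed.
Lemma closed_subspace_closed M : closed_subspace M -> closed M.
Proof. by case. Qed.
Lemma closed_subspaceD M x y : closed_subspace M -> M x -> M y -> M (x + y).
Proof.
by case/closed_subspaceP=> _ h _ Mx My; rewrite -[x]scale1r; apply: h.
Qed.
Lemma closed_subspaceZ M a x : closed_subspace M -> M x -> M (a *: x).
Proof.
by case/closed_subspaceP=> M0 h _ Mx; rewrite -[_ *: _]addr0; apply: h.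
Qed.
Lemma closed_subspaceB M x y : closed_subspace M -> M x -> M y -> M (x - y).
Proof.
move=> cM Mx My; rewrite -scaleN1r.
by apply: (closed_subspaceD cM Mx); apply: closed_subspaceZ.
Qed.

Lemma closed_subspaceT : closed_subspace [set: H].
Proof. by apply/closed_subspaceP; split=> //; apply: closedT. Qed.

Lemma closed_subspaceI M N : closed_subspace M -> closed_subspace N ->
  closed_subspace (M `&` N).
Proof.
move=> cM cN; apply/closed_subspaceP; split.
- by split; apply: closed_subspace0.
- move=> a x y [? ?] [? ?].
  by split; apply: closed_subspaceD => //; apply: closed_subspaceZ.
- by apply: closedI; apply: closed_subspace_closed.
Qed.

Lemma closed_subspace_bigcap (I : Type) (D : set I) (F : I -> set H) :
  (forall i, D i -> closed_subspace (F i)) ->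
  closed_subspace (\bigcap_(i in D) F i).
Proof.
move=> cF; apply/closed_subspaceP; split.
- by move=> i Di; apply: closed_subspace0; apply: cF.
- move=> a x y hx hy i Di; have cFi := cF i Di.
  by apply: (closed_subspaceD cFi); [apply: (closed_subspaceZ _ cFi)|]; auto.
- by apply: closed_bigI => i Di; apply: closed_subspace_closed; apply: cF.
Qed.

Lemma closed_subspace_smallest (X : set H) :
  closed_subspace (smallest (@closed_subspace R H) X).
Proof. by apply: closed_subspace_bigcap => M []. Qed.

Lemma closed_subspace_orth M : closed_subspace (orth_compl dot M).
Proof.
apply/closed_subspaceP; split.
- by move=> y _; rewrite dot0l.
- by move=> a x y hx hy z Mz; rewrite dotDl dotZl hx // hy // mulr0 addr0.
apply: approx_closed => x h y My; apply/normr0_eq0.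
have nn := nrm_ge0 y.
apply/eqP; rewrite eq_le normr_ge0 andbT.
apply/ler_addgt0Pl => e e0; rewrite addr0.
have eE : e = (complex.Re e)%:C%C by rewrite RRe_real // gtr0_real.
have e0' : 0 < complex.Re e by rewrite -ltcR -eE.
have /h[z zM xz] : 0 < complex.Re e / (nrm y + 1) by rewrite divr_gt0 //; lra.
have -> : dot x y = dot (x - z) y by rewrite dotBl zM // subr0.
apply: le_trans (cauchy_schwarz dotE _ _) _.
rewrite eE !nrmE -rmorphM lecR.
have [->|y0] := eqVneq (nrm y) 0; first by rewrite mulr0; exact: ltW.
rewrite -ler_pdivlMr ?lt_def ?y0 //.
apply: le_trans (ltW xz) _; rewrite ler_pM2l //.
rewrite lef_pV2 ?posrE ?lt_def ?y0 //; lra.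
Qed.

End ClosedSubspaces.

(** * Nearest points *)

Section Isometries.
Variables (R : realType) (H : completeNormedModType R[i]).
Variable dot : {dot H for (@Num.conj R[i])}.
Hypothesis dotE : hilbert_dot dot.
Implicit Types (x y z u v : H) (M N : set H) (e r : R).
Variable T : {linear H -> H}.
Hypothesis isoT : isometry_on setT T.

Lemma nrm_iso x : nrm (T x) = nrm x.
Proof. by rewrite /nrm; have [_ ->] := isoT (x := x) I. Qed.

(** Polarization: the norms of x + y and of x + i y determine the inner product. *)
Lemma dot_iso x y : dot (T x) (T y) = dot x y.
Proof.
have q u : dot (T u) (T u) = dot u u by rewrite !(dotxx dotE) nrm_iso.
have TD u v : T (u + v) = T u + T v by rewrite linearD.
have TZ a u : T (a *: u) = a *: T u by rewrite linearZ.
have := q (x + y); have := q (x + 'i *: y).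
rewrite !TD !TZ !(dotDl, dotDr, dotZl, dotZr) !q /= conjCi.
set a := dot x y; set b := dot y x.
set a' := dot (T x) (T y); set b' := dot (T y) (T x) => h1 h2.
have diff (c c2 : R[i]) : c = c2 -> c - c2 = 0 by move=> ->; rewrite subrr.
move/diff: h1 => h1; move/diff: h2 => h2.
have i0 : 2 * 'i != 0 :> R[i] by rewrite mulf_neq0 ?neq0Ci ?pnatr_eq0.
apply/subr0_eq/(mulfI i0); rewrite mulr0.
(* h2 compares a + b with a' + b' and h1 compares i (b - a) with i (b' - a'). *)
transitivity ('i * 0 - 0 : R[i]); last by rewrite mulr0 subr0.
by rewrite -{1}h2 -h1; ring.
Qed.

(** By the parallelogram law the points of M whose images come within e of the
    distance from y to T(M) have diameter tending to 0 with e, so they form a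
    Cauchy filter, and its limit realizes the distance. The isometry T is kept
    general because T = id gives orthogonal projections, M = H gives the adjoint
    of T, and both together the closedness of T(M). *)
Lemma nearest_point M y : closed_subspace M ->
  exists2 z, M z & forall x, M x -> dot (T x) (y - T z) = 0.
Proof.
move=> cM; pose S := [set nrm (y - T x) | x in M].
have infS : has_inf S.
  split; first by exists (nrm (y - T 0)), 0 => //; apply: closed_subspace0.
  by exists 0 => _ [x _ <-]; apply: nrm_ge0.
pose d := inf S.
have dle x : M x -> d <= nrm (y - T x).
  by move=> Mx; apply: ge_inf; [exact: infS.2|exists x].
have d0 : 0 <= d by apply: lb_le_inf infS.1 _ => _ [x _ <-]; apply: nrm_ge0.
pose A e := [set x | M x /\ nrm (y - T x) < d + e].
have A0 e : 0 < e -> A e !=set0.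
  by move=> e0; have [_ [x Mx <-] xe] := inf_adherent e0 infS; exists x.
pose F := filter_from [set e | 0 < e] A.
have FF : ProperFilter F.
  apply: filter_from_proper A0.
  apply: filter_from_filter; first by exists 1 => /=.
  move=> e r /= e0 r0; exists (Num.min e r); first by rewrite /= lt_min e0.
  move=> x [Mx xe]; split; split=> //; apply: lt_le_trans xe _;
    by rewrite lerD2l ge_min lexx ?orbT.
(* The midpoint of x and u lies in M, so its image is at distance at least d. *)
have close e x u : 0 < e -> A e x -> A e u ->
    nrm (x - u) ^+ 2 <= 8 * d * e + 4 * e ^+ 2.
  move=> e0 [Mx xe] [Mu ue].
  have := parallelogram dotE (y - T x) (y - T u).
  have -> : y - T x - (y - T u) = T (u - x).
    by rewrite (linearB T) opprB addrC addrA subrK.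
  have -> : y - T x + (y - T u) = 2%:R *: (y - T (2%:R^-1 *: (x + u))).
    rewrite scalerBr -linearZ /= scalerA divff ?pnatr_eq0 // scale1r linearD.
    by rewrite scaler_nat mulr2n opprD addrACA.
  rewrite nrm_iso -[nrm (u - x)]nrmN opprB.
  have -> v : nrm (2%:R *: v) = 2 * nrm v.
    by apply: complexI; rewrite nrmZ rmorphM /= normr_nat rmorph_nat.
  have : d <= nrm (y - T (2%:R^-1 *: (x + u))).
    by apply: dle; apply: (closed_subspaceZ _ cM); apply: (closed_subspaceD cM).
  have := dle _ Mx; have := dle _ Mu.
  move: (nrm _) (nrm _) (nrm _) (nrm _) xe ue => p q t w xe ue; nra.
have Fcauchy : cauchy F.
  apply: cauchy_exP => e e_gt0.
  have eE : e = (complex.Re e)%:C%C by rewrite RRe_real // gtr0_real.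
  set r := complex.Re e in eE.
  have r0 : 0 < r by rewrite -ltcR -eE.
  have D0 : 0 < 8 * d + 5 by lra.
  (* If eps <= 1 then 8 d eps + 4 eps ^ 2 < (8 d + 5) eps. *)
  pose eps := Num.min 1 (r ^+ 2 / (8 * d + 5)).
  have eps0 : 0 < eps by rewrite lt_min ltr01 divr_gt0 ?exprn_gt0.
  have [x Ax] := A0 _ eps0; exists x; exists eps => // u Au.
  rewrite -ball_normE /= eE nrmE ltcR.
  rewrite -(ltr_pXn2r (ltn0Sn 1)) ?nnegrE ?nrm_ge0 ?ltW //.
  apply: le_lt_trans (close _ _ _ eps0 Ax Au) _.
  have eps1 : eps <= 1 by rewrite ge_min lexx.
  have : eps * (8 * d + 5) <= r ^+ 2.
    by rewrite -ler_pdivlMr // ge_min lexx orbT.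
  nra.
have Fz := (cauchy_cvgP F).1 Fcauchy; set z := lim F in Fz.
have near_z e : 0 < e -> exists2 x, A e x & nrm (z - x) < e.
  move=> e0; have Fe : F (A e) by exists e.
  have Fb : F (ball z e%:C%C) by apply: Fz; apply: nbhsx_ballx; rewrite ltcR.
  have [x [Ax xz]] := filter_ex (filterI Fe Fb); exists x => //.
  by move: xz; rewrite -ball_normE /= nrmE ltcR.
have Mz : M z.
  apply: closed_approx (closed_subspace_closed cM) _ => e /near_z[x [Mx _] xz].
  by exists x.
have zd : nrm (y - T z) <= d.
  apply/ler_addgt0Pl => e e0.
  have [|x [Mx xd] xz] := near_z (e / 2); first by lra.
  have -> : y - T z = (y - T x) + T (x - z) by rewrite (linearB T) addrA subrK.
  apply: le_trans (nrmD _ _) _; rewrite nrm_iso -[nrm (x - z)]nrmN opprB; lra.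
exists z => // x Mx; set w := y - T z in zd *.
have [-> | Tx0] := eqVneq (T x) 0; first by rewrite dot0l.
apply: dotC0; apply/normr0_eq0/eqP; rewrite -sqrf_eq0.
(* z + c x, with c T x the projection of w onto the line of T x, would be
   strictly nearer than z. *)
have Txx : 0 < dot (T x) (T x) by rewrite dnorm_gt0.
have := dot_residual dot w Tx0; set c := _ / _ => /= cE.
have : d <= nrm (w - c *: T x).
  have -> : w - c *: T x = y - T (z + c *: x).
    by rewrite /w (linearD T) (linearZ_LR T) opprD addrA.
  by apply: dle; apply: (closed_subspaceD cM Mz); apply: closed_subspaceZ.
move=> dw; have : dot w w <= dot (w - c *: T x) (w - c *: T x).
  rewrite !(dotxx dotE) lecR ler_pXn2r ?nnegrE ?nrm_ge0 //.
  exact: le_trans zd dw.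
rewrite cE lerDl oppr_ge0 pmulr_lle0 ?invr_gt0 //.
by move=> h; rewrite eq_le h exprn_ge0.
Qed.

End Isometries.

(** * Orthogonal projections *)

Section Projections.
Variables (R : realType) (H : completeNormedModType R[i]).
Variable dot : {dot H for (@Num.conj R[i])}.
Hypothesis dotE : hilbert_dot dot.
Implicit Types (x y z u v : H) (M N : set H).

Local Notation orth := (orth_compl dot).

Lemma orth_decomposition M y : closed_subspace M ->
  exists u v, [/\ M u, orth M v & y = u + v].
Proof.
have iso_id : isometry_on setT (idfun : {linear H -> H}) by [].
move=> /(nearest_point dotE iso_id y)[z Mz h]; exists z, (y - z); split=> //.
  by move=> x Mx; apply: dotC0; exact: h.
by rewrite addrC subrK.
Qed.

Lemma orth_self M x : M x -> orth M x -> x = 0.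
Proof. by move=> Mx /(_ _ Mx) /dotxx0. Qed.

Lemma sub_orthK M : M `<=` orth (orth M).
Proof. by move=> x Mx y /(_ _ Mx) /dotC0. Qed.

Lemma orthS M N : M `<=` N -> orth N `<=` orth M.
Proof. by move=> MN x h y /MN /h. Qed.

Lemma orthK M : closed_subspace M -> orth (orth M) `<=` M.
Proof.
move=> cM x xM; have [u [v [Mu Mv xE]]] := orth_decomposition x cM.
suff v0 : v = 0 by rewrite xE v0 addr0.
apply: (orth_self Mv); rewrite (_ : v = x - u); last by rewrite xE addrC addKr.
apply: (closed_subspaceB (closed_subspace_orth dotE _)) => //.
exact: sub_orthK.
Qed.

Lemma span_eq M (X : set H) : closed_subspace M -> X `<=` M ->
  (forall q, M q -> orth X q -> q = 0) ->
  M = smallest (@closed_subspace R H) X.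
Proof.
move=> cM XM h; apply/seteqP; split; last exact: smallest_sub.
have cS := closed_subspace_smallest X.
have SM : smallest (@closed_subspace R H) X `<=` M by apply: smallest_sub.
move=> x Mx; have [u [v [Su Sv xE]]] := orth_decomposition x cS.
suff v0 : v = 0 by rewrite xE v0 addr0.
apply: h; last by apply: orthS Sv; exact: sub_gen_smallest.
rewrite (_ : v = x - u); last by rewrite xE addrC addKr.
by apply: (closed_subspaceB cM) => //; exact: SM.
Qed.

End Projections.

(** * Adjoints and reducing subspaces *)

Section Adjoint.
Variables (R : realType) (H : completeNormedModType R[i]).
Variable dot : {dot H for (@Num.conj R[i])}.
Hypothesis dotE : hilbert_dot dot.
Implicit Types (x y z u v : H) (M N : set H).

Local Notation orth := (orth_compl dot).

Lemma adjoint_on_unique M (A B : H -> H) : closed_subspace M ->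
  (forall y, M y -> M (B y)) ->
  (forall x y, M x -> M y -> dot (A x) y = dot x (B y)) ->
  forall y, M y -> adjoint_on dot M A y = B y.
Proof.
move=> cM MB AB y My; apply: xget_unique.
  by split; [exact: MB|move=> x Mx; exact: AB].
move=> z [Mz zE]; apply/subr0_eq/(dotxx0 (dot := dot)).
have Mw : M (z - B y) by apply: (closed_subspaceB cM) => //; exact: MB.
by rewrite dotBr -zE // -AB // subrr.
Qed.

Lemma adjoint_unique (A B : H -> H) :
  (forall x y, dot (A x) y = dot x (B y)) -> adjoint dot A = B.
Proof.
move=> AB; apply/funext => y.
by apply: adjoint_on_unique => //; exact: closed_subspaceT.
Qed.

Variable T : {linear H -> H}.
Hypothesis isoT : isometry_on setT T.
Local Notation T' := (adjoint dot T).

(** As T is isometric, the preimage under T of the projection of y onto the range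
    of T represents the functional x |-> dot (T x) y. *)
Lemma adj_dot x y : dot (T x) y = dot x (T' y).
Proof.
have [z _ zE] := nearest_point dotE isoT y (closed_subspaceT H).
rewrite /adjoint /adjoint_on; case: xgetP => [w _ [_ ->] //|] /(_ z)[].
split=> // u _; rewrite -(dot_iso dotE isoT u z); apply/eqP; rewrite -subr_eq0.
by rewrite -dotBr zE.
Qed.

Lemma adj_dotC x y : dot (T' x) y = dot x (T y).
Proof. by rewrite dotC -adj_dot -dotC. Qed.

Lemma adjD x y : T' (x + y) = T' x + T' y.
Proof. by apply: (eq_dot (dot := dot)) => z; rewrite dotDr -!adj_dot dotDr. Qed.

Lemma adjZ a x : T' (a *: x) = a *: T' x.
Proof. by apply: (eq_dot (dot := dot)) => z; rewrite dotZr -!adj_dot dotZr. Qed.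

Lemma adjB x y : T' (x - y) = T' x - T' y.
Proof. by apply: (eq_dot (dot := dot)) => z; rewrite dotBr -!adj_dot dotBr. Qed.

Lemma adjK x : T' (T x) = x.
Proof.
by apply: (eq_dot (dot := dot)) => z; rewrite -adj_dot (dot_iso dotE isoT).
Qed.

(** The squared norm of T' x is the inner product of x with T (T' x), at most
    the product of the norms of x and T' x. *)
Lemma nrm_adj x : nrm (T' x) <= nrm x.
Proof.
have [->|x0] := eqVneq (nrm (T' x)) 0; first exact: nrm_ge0.
have Tx_gt0 : 0 < nrm (T' x) by rewrite lt_def x0 nrm_ge0.
rewrite -(ler_pM2r Tx_gt0) -expr2 -lecR -(dotxx dotE) rmorphM /=.
have := cauchy_schwarz dotE x (T (T' x)).
by rewrite -adj_dotC !nrmE (nrm_iso isoT) ger0_norm.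
Qed.

Lemma iter_adj_dot m x y : dot (iter m T x) y = dot x (iter m T' y).
Proof. by elim: m x y => // m IH x y; rewrite iterSr IH /= adj_dot. Qed.

Lemma iter_linD m x y : iter m T (x + y) = iter m T x + iter m T y.
Proof. by elim: m => //= m ->; rewrite (linearD T). Qed.

Lemma iter_adjD m x y : iter m T' (x + y) = iter m T' x + iter m T' y.
Proof. by elim: m => //= m ->; rewrite adjD. Qed.

Lemma iter_adjZ m a x : iter m T' (a *: x) = a *: iter m T' x.
Proof. by elim: m => //= m ->; rewrite adjZ. Qed.

Lemma nrm_iter_adj m k x : (m <= k)%N ->
  nrm (iter k T' x) <= nrm (iter m T' x).
Proof.
move=> /subnK <-; rewrite iterD; elim: (k - m)%N => //= p IH.
exact: le_trans (nrm_adj _) IH.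
Qed.

(** A limit y of points of T(M) lies in the double orthogonal complement of
    T(M), and so does its residual y - T z at the nearest point T z; as that
    residual is also orthogonal to T(M), it vanishes. *)
Lemma closed_subspace_image M : closed_subspace M -> closed_subspace (T @` M).
Proof.
move=> cM; have cO := closed_subspace_orth dotE (orth (T @` M)).
apply/closed_subspaceP; split.
- by exists 0; [exact: closed_subspace0|rewrite linear0].
- move=> a _ _ [x Mx <-] [y My <-]; exists (a *: x + y).
    by apply: (closed_subspaceD cM) => //; apply: closed_subspaceZ.
  by rewrite linearP.
apply: approx_closed => y yT; have [z Mz zE] := nearest_point dotE isoT y cM.
have Oy : orth (orth (T @` M)) y.
  apply: closed_approx (closed_subspace_closed cO) _ => e /yT[u Tu yu].
  exists u => //.
  exact: sub_orthK.
exists z => //; apply/esym/subr0_eq.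
apply: (@orth_self _ _ dot (orth (T @` M))).
  by move=> _ [x Mx <-]; apply/dotC0/zE.
by apply: (closed_subspaceB cO) => //; apply: sub_orthK; exists z.
Qed.

(** This is reduction by T in a form that makes sense for any set and is stable
    under intersections and orthogonal complements. *)
Definition doubly_invariant M :=
  (forall x, M x -> M (T x)) /\ (forall x, M x -> M (T' x)).

Lemma doubly_invariant_orth M : doubly_invariant M -> doubly_invariant (orth M).
Proof.
move=> [MT MT']; split=> x h y My; first by rewrite adj_dot h //; exact: MT'.
by rewrite adj_dotC h //; exact: MT.
Qed.

Lemma doubly_invariantI M N : doubly_invariant M -> doubly_invariant N ->
  doubly_invariant (M `&` N).
Proof. by move=> [? ?] [? ?]; split=> x [? ?]; split; auto. Qed.

Lemma doubly_invariant_bigcap (I : Type) (D : set I) (F : I -> set H) :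
  (forall i, D i -> doubly_invariant (F i)) ->
  doubly_invariant (\bigcap_(i in D) F i).
Proof.
by move=> FI; split=> x h i Di; have [? ?] := FI i Di; have := h i Di; auto.
Qed.

Lemma reducesP M :
  reduces dot M T <-> closed_subspace M /\ doubly_invariant M.
Proof.
split=> [[cM MT OT]|[cM IM]].
  split=> //; split=> x Mx; first by apply: MT; exists x.
  apply: (orthK dotE cM) => v Ov; rewrite adj_dotC.
  by apply: dotC0; apply: (OT (T v)); first by exists v.
split=> //; first by move=> _ [x Mx <-]; exact: IM.1.
by move=> _ [x Mx <-]; exact: (doubly_invariant_orth IM).1.
Qed.

Lemma adjoint_on_doubly_invariant M : closed_subspace M -> doubly_invariant M ->
  forall x, M x -> adjoint_on dot M T x = T' x.
Proof.
move=> cM [_ MT']; apply: adjoint_on_unique => // x y _ _; exact: adj_dot.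
Qed.

Lemma iter_adjoint_on_doubly_invariant M m :
  closed_subspace M -> doubly_invariant M -> forall x, M x ->
  M (iter m T' x) /\ iter m (adjoint_on dot M T) x = iter m T' x.
Proof.
move=> cM IM x Mx; elim: m => //= m [Mm ->]; split; first exact: IM.2.
exact: adjoint_on_doubly_invariant.
Qed.

End Adjoint.

(** * The Wold decomposition of one isometry *)

Section Wold.
Variables (R : realType) (H : completeNormedModType R[i]).
Variable dot : {dot H for (@Num.conj R[i])}.
Hypothesis dotE : hilbert_dot dot.
Variable T : {linear H -> H}.
Hypothesis isoT : isometry_on setT T.
Implicit Types (x y z u v : H) (M N : set H).

Local Notation orth := (orth_compl dot).
Local Notation T' := (adjoint dot T).

Definition iter_range m : set H := range (iter m T).
Definition unitary_part : set H := \bigcap_m iter_range m.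
Definition shift_part : set H := orth unitary_part.

Lemma iter_rangeS m : iter_range m.+1 = T @` iter_range m.
Proof.
apply/seteqP; split=> [_ [x _ <-]|_ [_ [x _ <-] <-]]; last by exists x.
by exists (iter m T x) => //; exists x.
Qed.

Lemma iter_rangeSW m : iter_range m.+1 `<=` iter_range m.
Proof. by move=> _ [x _ <-]; exists (T x); rewrite // iterSr. Qed.

Lemma iter_range_le m k : (m <= k)%N -> iter_range k `<=` iter_range m.
Proof.
move=> /subnK <-; elim: (k - m)%N => //= p IH.
exact: subset_trans (@iter_rangeSW _) IH.
Qed.

Lemma closed_subspace_iter_range m : closed_subspace (iter_range m).
Proof.
elim: m => [|m IH]; last first.
  by rewrite iter_rangeS; exact: (closed_subspace_image dotE).
have -> : iter_range 0 = setT by apply/seteqP; split=> // x _; exists x.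
exact: closed_subspaceT.
Qed.

Lemma closed_subspace_unitary_part : closed_subspace unitary_part.
Proof.
by apply: closed_subspace_bigcap => m _; exact: closed_subspace_iter_range.
Qed.

Lemma closed_subspace_shift_part : closed_subspace shift_part.
Proof. exact: closed_subspace_orth. Qed.

Lemma doubly_invariant_unitary_part : doubly_invariant dot T unitary_part.
Proof.
split=> x h m _.
  by apply: iter_rangeSW; rewrite iter_rangeS; exists x => //; exact: h.
by have [y _ <-] := h m.+1 I; exists y => //=; rewrite (adjK dotE).
Qed.

Lemma adjKV x : iter_range 1 x -> T (T' x) = x.
Proof. by case=> y _ <-; rewrite /= (adjK dotE). Qed.

Lemma unitary_part_adjKV x : unitary_part x -> T (T' x) = x.
Proof. by move=> /(_ 1%N I) /adjKV. Qed.

Lemma orth_iter_range m x : orth (iter_range m) x -> iter m T' x = 0.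
Proof.
move=> h; apply: (dotxx0 (dot := dot)).
rewrite -(iter_adj_dot dotE) //; apply: dotC0.
by apply: h; exists (iter m T' x).
Qed.

Lemma orth_iter_rangeS m x :
  orth (iter_range m) x -> orth (iter_range m.+1) (T x).
Proof.
by move=> h; rewrite iter_rangeS => _ [y My <-]; rewrite (dot_iso dotE) // h.
Qed.

(** The vectors on which the powers of T' tend to 0 form a closed subspace D, as
    these powers are contractions, and D contains every vector orthogonal to the
    range of some power of T. A vector orthogonal to D then lies in all these
    ranges, that is in the unitary part; taking complements, the shift part is
    contained in D. *)
Lemma shift_part_adj0 x : shift_part x ->
  (fun m => iter m T' x) @ \oo --> (0 : H).
Proof.
pose D := [set y | forall e : R, 0 < e -> exists m, nrm (iter m T' y) < e].
(* Norms along the orbit decrease, so one small term replaces the limit. *)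
have cD : closed_subspace D.
  apply/closed_subspaceP; split.
  - by move=> e e0; exists 0%N; rewrite /= /nrm normr0.
  - move=> a y z hy hz e e0.
    have a1 : 0 < complex.Re `|a| + 1.
      by rewrite ltr_wpDl // -lecR RRe_real ?normr_real //; exact: normr_ge0.
    have [|m ym] := hy (e / 2 / (complex.Re `|a| + 1)).
      by rewrite !divr_gt0.
    have [|k zk] := hz (e / 2); first by rewrite divr_gt0.
    exists (maxn m k); rewrite iter_adjD // iter_adjZ //.
    apply: le_lt_trans (nrmD _ _) _.
    have zle : nrm (iter (maxn m k) T' z) < e / 2.
      by apply: le_lt_trans (nrm_iter_adj dotE isoT _ (leq_maxr _ _)) zk.
    have yle : nrm (iter (maxn m k) T' y) < e / 2 / (complex.Re `|a| + 1).
      by apply: le_lt_trans (nrm_iter_adj dotE isoT _ (leq_maxl _ _)) ym.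
    have aE (w : H) : nrm (a *: w) = complex.Re `|a| * nrm w.
      by apply: complexI; rewrite nrmZ rmorphM /= RRe_real ?normr_real.
    move: yle; rewrite aE ltr_pdivlMr // => yle.
    have := nrm_ge0 (iter (maxn m k) T' y); nra.
  - apply: approx_closed => y h e e0.
    have [|z Dz yz] := h (e / 2); first by rewrite divr_gt0.
    have [|m zm] := Dz (e / 2); first by rewrite divr_gt0.
    exists m; rewrite -[y](subrK z) iter_adjD //.
    apply: le_lt_trans (nrmD _ _) _.
    have := nrm_iter_adj dotE isoT (y - z) (leq0n m) => /=; lra.
have DI m : orth (iter_range m) `<=` D.
  by move=> y /orth_iter_range y0 e e0; exists m; rewrite y0 /nrm normr0.
have DU : orth D `<=` unitary_part.
  move=> y Dy m _; apply: (orthK dotE (closed_subspace_iter_range m)).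
  exact: orthS (DI m) _ Dy.
move=> /(orthS DU) /(orthK dotE cD) Dx.
apply/cvgrPdist_lt => e e0.
have eE : e = (complex.Re e)%:C%C by rewrite RRe_real // gtr0_real.
have [|m xm] := Dx (complex.Re e); first by rewrite -ltcR -eE.
exists m => // k /= mk; rewrite sub0r normrN eE nrmE ltcR.
exact: le_lt_trans (nrm_iter_adj dotE isoT _ mk) xm.
Qed.

(** The projection of x onto the intersection of M and the unitary part leaves a
    residual orthogonal to the whole unitary part, because projecting a vector of
    the unitary part onto M does not leave the unitary part. *)
Lemma wold_split M x : closed_subspace M -> doubly_invariant dot T M -> M x ->
  exists u v, [/\ (M `&` unitary_part) u, (M `&` shift_part) v & x = u + v].
Proof.
move=> cM IM Mx.
have cMU := closed_subspaceI cM closed_subspace_unitary_part.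
have [u [v [[Mu Uu] vP xE]]] := orth_decomposition dotE x cMU.
have Mv : M v.
  by rewrite (_ : v = x - u); [exact: closed_subspaceB|rewrite xE addrC addKr].
exists u, v; split=> //; split=> // w Uw.
have [a [b [Ma Mb wE]]] := orth_decomposition dotE w cM.
have Oinv := doubly_invariant_orth dotE isoT IM.
have itM N m y : doubly_invariant dot T N -> N y -> N (iter m T y).
  by move=> [NT _] Ny; elim: m => //= m; exact: NT.
suff Ua : unitary_part a.
  by rewrite wE dotDr (vP a) // add0r; apply: dotC0; exact: Mb.
(* The projection onto M commutes with the powers of T. *)
move=> m _; have [w' _ w'E] := Uw m I.
have [a' [b' [Ma' Mb' w'D]]] := orth_decomposition dotE w' cM.
exists a' => //; apply/subr0_eq.
apply: (@orth_self _ _ dot M).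
  by apply: (closed_subspaceB cM) => //; exact: itM.
have -> : iter m T a' - a = b - iter m T b'.
  apply/eqP; rewrite subr_eq eq_sym addrAC subr_eq addrC -wE.
  by rewrite -w'E w'D iter_linD.
apply: (closed_subspaceB (closed_subspace_orth dotE M)) => //.
exact: (itM _ _ _ Oinv).
Qed.

Lemma unitary_on_sub M : closed_subspace M -> unitary_on dot M T ->
  M `<=` unitary_part.
Proof.
move=> cM uM x Mx m _; elim: m x Mx => [|m IH] x Mx; first by exists x.
rewrite iter_rangeS; have [_ _ xE] := uM x Mx.
exists (adjoint_on dot M T x) => //; apply: IH.
by rewrite /adjoint_on; case: xgetP => [y _ []|_] //; exact: closed_subspace0.
Qed.

(** For v = T^m w in the unitary part, the inner product of x and v is that of
    T'^m x and w, where w has the norm of v: it tends to 0 with m. *)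
Lemma shift_on_sub M : closed_subspace M -> doubly_invariant dot T M ->
  shift_on dot M T -> M `<=` shift_part.
Proof.
move=> cM IM [_ sM] x Mx v Uv; apply/normr0_eq0/eqP.
rewrite eq_le normr_ge0 andbT; apply/ler_addgt0Pl => e e0; rewrite addr0.
have v1 : 0 < `|v| + 1 by rewrite ltr_wpDl.
have /cvgrPdist_lt/(_ (e / (`|v| + 1)))[|m _ /(_ m (leqnn m))] := sM x Mx.
  by rewrite divr_gt0.
rewrite sub0r normrN.
rewrite (iter_adjoint_on_doubly_invariant dotE isoT m cM IM Mx).2 => xm.
have [w _ vE] := Uv m I.
rewrite dotC -vE (iter_adj_dot dotE) // norm_conjC.
apply: le_trans (cauchy_schwarz dotE _ _) _.
have -> : `|w| = `|v|.
  rewrite -vE; elim: (m) => //= k ->.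
  by have [_ ->] := isoT (x := iter k T w) I.
apply: le_trans (_ : (`|v| + 1) * (e / (`|v| + 1)) <= _).
  apply: ler_pM => //; [by rewrite lerDl|exact: ltW].
by rewrite mulrCA divff ?mulr1 // gt_eqF.
Qed.

Lemma unitary_on_unitary_part M : closed_subspace M ->
  doubly_invariant dot T M -> M `<=` unitary_part -> unitary_on dot M T.
Proof.
move=> cM IM MU x Mx; split; first exact: IM.1.
  by rewrite (adjoint_on_doubly_invariant dotE) // ?(adjK dotE) //; exact: IM.1.
rewrite (adjoint_on_doubly_invariant dotE) // unitary_part_adjKV //.
exact: MU.
Qed.

Lemma shift_on_shift_part M : closed_subspace M ->
  doubly_invariant dot T M -> M `<=` shift_part -> shift_on dot M T.
Proof.
move=> cM IM MS; split=> x Mx.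
  by split; [exact: IM.1|have [] := isoT (x := x) I].
rewrite (_ : (fun m => _) = (fun m => iter m T' x)).
  by apply: shift_part_adj0; exact: MS.
apply/funext => m.
by rewrite (iter_adjoint_on_doubly_invariant dotE isoT m cM IM Mx).2.
Qed.

(** Otherwise T' could be undone by T along the whole orbit of x under T', which
    would put x into the unitary part. *)
Lemma shift_part_wandering x : shift_part x -> x != 0 ->
  exists m, iter m T' x - T (T' (iter m T' x)) != 0.
Proof.
move=> Sx x0; apply: contrapT => h.
have {}h m : iter m T' x = T (iter m.+1 T' x).
  by apply/subr0_eq/eqP/negPn/negP => hm; apply: h; exists m.
suff : unitary_part x by move=> /orth_self/(_ Sx) xE; rewrite xE eqxx in x0.
move=> m _; exists (iter m T' x) => //.
by elim: m => // m IH; rewrite iterSr -h IH.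
Qed.

(** A maps T^m x to T^m (V^m (A x)). *)
Lemma iter_range_comm (A V : H -> H) m :
  (forall x, V (T x) = T (V x)) -> (forall x, A (T x) = T (V (A x))) ->
  forall x, iter_range m x -> iter_range m (A x).
Proof.
move=> VT AT _ [x _ <-].
have VTm k y : V (iter k T y) = iter k T (V y) by elim: k => //= k <-.
elim: m => [|m [y _ yE]] /=; first by exists (A x).
by exists (V y) => //=; rewrite AT -yE VTm.
Qed.

End Wold.

(** * The parts of a tuple of isometries *)

Section Multivariate.
Variables (R : realType) (H : completeNormedModType R[i]).
Variable dot : {dot H for (@Num.conj R[i])}.
Hypothesis dotE : hilbert_dot dot.
Variables (n : nat) (T : 'I_n -> {linear H -> H}).
Hypothesis isoT : forall i, isometry_on setT (T i).
(* All that the decomposition needs to know about the twist; it is derived in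
   [twisted_doubly_invariant_iter_range]. *)
Hypothesis doubly_invariant_iter_range : forall i j m, i != j ->
  doubly_invariant dot (T j) (iter_range (T i) m).
Implicit Types (x y z u v : H) (M N : set H) (L : {set 'I_n}).

Local Notation orth := (orth_compl dot).
Local Notation adj i := (adjoint dot (T i)).

(** The kernel of the adjoint of T i, see [wandering1P]. *)
Definition wandering1 i : set H := orth (iter_range (T i) 1).

Definition wold_factor L i : set H :=
  if i \in L then shift_part dot (T i) else unitary_part (T i).

Definition wold_part L : set H := \bigcap_i wold_factor L i.

(** The subspace whose translates by the powers of the T i, i in L, make up
    [wold_part L]; compare [wold_coreE]. *)
Definition wold_core L : set H :=
  \bigcap_i (if i \in L then wandering1 i else unitary_part (T i)).

Lemma closed_subspace_wold_factor L i : closed_subspace (wold_factor L i).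
Proof.
rewrite /wold_factor; case: ifP => _; first exact: closed_subspace_shift_part.
exact: (closed_subspace_unitary_part dotE).
Qed.

Lemma closed_subspace_wold_part L : closed_subspace (wold_part L).
Proof.
by apply: closed_subspace_bigcap => i _; exact: closed_subspace_wold_factor.
Qed.

Lemma closed_subspace_wandering1 i : closed_subspace (wandering1 i).
Proof. exact: closed_subspace_orth. Qed.

Lemma closed_subspace_wold_core L : closed_subspace (wold_core L).
Proof.
apply: closed_subspace_bigcap => i _.
case: ifP => _; first exact: closed_subspace_wandering1.
exact: (closed_subspace_unitary_part dotE).
Qed.

Lemma doubly_invariant_unitary i j :
  doubly_invariant dot (T j) (unitary_part (T i)).
Proof.
have [<-|ij] := eqVneq i j; first exact: doubly_invariant_unitary_part.
by apply: doubly_invariant_bigcap => m _; exact: doubly_invariant_iter_range.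
Qed.

Lemma doubly_invariant_wandering1 i j :
  i != j -> doubly_invariant dot (T j) (wandering1 i).
Proof.
move=> ij; apply: doubly_invariant_orth => //.
exact: doubly_invariant_iter_range.
Qed.

Lemma doubly_invariant_wold_part L j : doubly_invariant dot (T j) (wold_part L).
Proof.
apply: doubly_invariant_bigcap => i _; rewrite /wold_factor.
by case: ifP => _; [apply: doubly_invariant_orth => //|];
  exact: doubly_invariant_unitary.
Qed.

Lemma doubly_invariant_wold_core L j :
  j \notin L -> doubly_invariant dot (T j) (wold_core L).
Proof.
move=> jL; apply: doubly_invariant_bigcap => i _.
case: ifP => iL; last exact: doubly_invariant_unitary.
by apply: doubly_invariant_wandering1; apply: contraNneq jL => <-.
Qed.

Lemma sub_wandering1 i : wandering1 i `<=` shift_part dot (T i).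
Proof. by apply: orthS => x; apply. Qed.

Lemma sub_wold_core L : wold_core L `<=` wold_part L.
Proof.
move=> x h i _; have := h i I; rewrite /wold_factor; case: ifP => // _.
exact: sub_wandering1.
Qed.

(** The index sets differ at some i, where one part lies in the unitary part of
    T i and the other in its orthogonal complement. *)
Lemma wold_part_orth L L' : L <> L' -> wold_part L `<=` orth (wold_part L').
Proof.
move=> LL' x xL y yL'.
have [i iLL'] : exists i, (i \in L) != (i \in L').
  apply: contrapT => h; apply: LL'; apply/setP => i; apply/eqP/negPn/negP => hi.
  by apply: h; exists i.
have := xL i I; have := yL' i I; rewrite /wold_factor; move: iLL'.
case: (i \in L); case: (i \in L') => // _; first by move=> ? /(_ y); auto.
by move=> /(_ x) h ?; apply: dotC0; auto.
Qed.

(** Splitting M along the Wold decomposition of each T i, i in s, decomposes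
    every vector of M into vectors belonging to the parts. Generality in M makes
    the induction go through: the two summands for the first index are again
    closed and reduce every T j. *)
Lemma wold_span (s : seq 'I_n) M N : uniq s -> closed_subspace N ->
  closed_subspace M -> (forall j, doubly_invariant dot (T j) M) ->
  (forall L x, M x -> (forall i, i \in s -> wold_factor L i x) -> N x) ->
  M `<=` N.
Proof.
move=> + cN; elim: s M => [|i s IH] M /= us cM IM h.
  by move=> x Mx; apply: (h finset.set0).
move: us => /andP[iNs us] x Mx.
have [u [v [[Mu Uu] [Mv Sv] ->]]] := wold_split dotE (isoT i) cM (IM i) Mx.
apply: (closed_subspaceD cN).
  apply: (IH (M `&` unitary_part (T i))) => //.
  - by apply: closed_subspaceI => //; exact: (closed_subspace_unitary_part dotE).
  - by move=> j; apply: doubly_invariantI => //; exact: doubly_invariant_unitary.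
  move=> L y [My Uy] Ly; apply: (h (L :\ i)%SET) => // j.
  rewrite inE => /predU1P[->|js].
    by rewrite /wold_factor !inE eqxx.
  have ji : j != i by apply: contraNneq iNs => <-.
  by have := Ly j js; rewrite /wold_factor !inE ji.
apply: (IH (M `&` shift_part dot (T i))) => //.
- by apply: closed_subspaceI => //; exact: closed_subspace_shift_part.
- move=> j; apply: doubly_invariantI => //; apply: doubly_invariant_orth => //.
  exact: doubly_invariant_unitary.
move=> L y [My Uy] Ly; apply: (h (i |: L)%SET) => // j.
rewrite inE => /predU1P[->|js].
  by rewrite /wold_factor !inE eqxx.
have ji : j != i by apply: contraNneq iNs => <-.
by have := Ly j js; rewrite /wold_factor !inE (negPf ji).
Qed.

Lemma wold_part_dsum : orth_dsum dot wold_part setT.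
Proof.
split; [exact: closed_subspace_wold_part|exact: wold_part_orth|].
apply/esym/seteqP; split=> // x _.
apply: (@wold_span (enum 'I_n) setT) => //.
- exact: enum_uniq.
- exact: closed_subspace_smallest.
- exact: closed_subspaceT.
move=> L y _ Ly; apply: (@sub_gen_smallest _ _ (\bigcup_L wold_part L)).
by exists L => // i _; apply: Ly; rewrite mem_enum.
Qed.

Lemma wold_partP : wold_decomposition dot T wold_part.
Proof.
have cP := closed_subspace_wold_part; have dP := doubly_invariant_wold_part.
split=> //; [|exact: wold_part_dsum|].
  move=> L i; apply/(reducesP dotE) => //; split; auto.
move=> L _ i; split=> iL.
  apply: (unitary_on_unitary_part dotE) => //.
  by move=> x /(_ i I); rewrite /wold_factor (negPf iL).
apply: (shift_on_shift_part dotE) => //.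
by move=> x /(_ i I); rewrite /wold_factor iL.
Qed.

(** The unitary and shift properties force K L into [wold_part L]. Conversely the
    component of a vector of [wold_part L] orthogonal to K L is orthogonal to every
    other K L' as well, hence to the closed span of all of them, which is H. *)
Lemma wold_part_unique K : wold_decomposition dot T K -> K = wold_part.
Proof.
move=> [cK rK [_ oK spanK] uK].
have sub L : K L `<=` wold_part L.
  move=> x Kx; have [K0|Kn0] := pselect (K L = [set 0]).
    move: Kx; rewrite K0 => ->.
    by apply: closed_subspace0; exact: closed_subspace_wold_part.
  move=> i _; have [uKi sKi] := uK L Kn0 i; rewrite /wold_factor.
  have /(reducesP dotE (isoT i))[_ IK] := rK L i.
  case: ifPn => iL; first exact: (shift_on_sub dotE _ _ IK (sKi iL)).
  exact: (unitary_on_sub _ (uKi iL)).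
apply/funext => L; apply/seteqP; split=> // x Px.
have [u [v [Ku Ov xE]]] := orth_decomposition dotE x (cK L).
suff v0 : v = 0 by rewrite xE v0 addr0.
have Pv : wold_part L v.
  rewrite (_ : v = x - u); last by rewrite xE addrC addKr.
  by apply: (closed_subspaceB (closed_subspace_wold_part L)) => //; exact: sub.
have : orth [set v] v; last by apply: orth_self.
suff : [set: H] `<=` orth [set v] by apply.
rewrite spanK; apply: smallest_sub; first exact: closed_subspace_orth.
move=> y [L' _ Ky] _ ->; apply: dotC0.
have [LL'|LL'] := pselect (L = L'); first by apply: Ov; rewrite LL'.
by apply: (wold_part_orth LL') => //; exact: sub.
Qed.

Definition wandering_proj i : H -> H := fun x => x - T i (adj i x).

Lemma wandering1P i x : wandering1 i x <-> adj i x = 0.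
Proof.
split=> [/(orth_iter_range dotE (isoT i)) //|x0 _ [y _ <-]].
by rewrite /= -(adj_dotC dotE (isoT i)) x0 dot0l.
Qed.

Lemma wandering_proj_mem i x : wandering1 i (wandering_proj i x).
Proof.
by apply/wandering1P; rewrite (adjB dotE (isoT i)) (adjK dotE (isoT i)) subrr.
Qed.

Lemma wandering_proj_id i x : wandering1 i x -> wandering_proj i x = x.
Proof. by move/wandering1P => x0; rewrite /wandering_proj x0 linear0 subr0. Qed.

Lemma wandering_proj_inv M i x : closed_subspace M ->
  doubly_invariant dot (T i) M -> M x -> M (wandering_proj i x).
Proof.
move=> cM [MT MT'] Mx; apply: (closed_subspaceB cM) => //.
by apply: MT; exact: MT'.
Qed.

(** The range of the product of the projections is the intersection of their
    ranges because each of them preserves the ranges of the others. *)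
Lemma wanderingE L : wandering dot T L = \bigcap_(i in [set` L]) wandering1 i.
Proof.
have proj_id (s : seq 'I_n) x : (forall i, i \in s -> wandering1 i x) ->
    (\big[comp/idfun]_(i <- s) wandering_proj i) x = x.
  elim: s => [|i s IH] h; first by rewrite big_nil.
  rewrite big_cons /= IH; last by move=> j js; apply: h; rewrite inE js orbT.
  by rewrite wandering_proj_id //; apply: h; rewrite mem_head.
have proj_mem (s : seq 'I_n) x i : i \in s ->
    wandering1 i ((\big[comp/idfun]_(i <- s) wandering_proj i) x).
  elim: s => // j s IH; rewrite big_cons inE /=.
  have [<- _|ij /= js] := eqVneq i j; first exact: wandering_proj_mem.
  apply: (wandering_proj_inv (closed_subspace_wandering1 i)).
    exact: doubly_invariant_wandering1.
  exact: IH.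
apply/seteqP; split=> [_ [x _ <-] i /= iL|x h].
  by apply: proj_mem; rewrite mem_enum.
by exists x => //; apply: proj_id => i; rewrite mem_enum => /h.
Qed.

(** * Products of powers *)

Section Powers.
Variable L : {set 'I_n}.
Let J := {i : 'I_n | i \in L}.
Implicit Types (s : seq J) (k m : multi_index L).

(* The product [tpow] over an arbitrary list, to allow induction on the list. *)
Local Notation prodT s m := (\big[comp/idfun]_(i <- s) iter (m i) (T (val i))).

Lemma iter_inv M i (p : nat) x :
  (forall y, M y -> M (T i y)) -> M x -> M (iter p (T i) x).
Proof. by move=> MT Mx; elim: p => //= p; exact: MT. Qed.

Lemma prodT_inv s m M x :
  (forall j : J, j \in s -> forall y, M y -> M (T (val j) y)) ->
  M x -> M ((prodT s m) x).
Proof.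
elim: s => [|j s IH] MT Mx; first by rewrite big_nil.
rewrite big_cons /=; apply: iter_inv; first by apply: MT; rewrite mem_head.
by apply: IH => // l ls; apply: MT; rewrite inE ls orbT.
Qed.

Lemma prodT_range s m x (i : J) : i \in s ->
  iter_range (T (val i)) (m i) ((prodT s m) x).
Proof.
elim: s => // j s IH; rewrite big_cons inE /=.
have [<- _|ij /= js] := eqVneq i j; first by exists ((prodT s m) x).
apply: iter_inv (IH js) => y; apply: (doubly_invariant_iter_range _ _).1.
by rewrite (inj_eq val_inj).
Qed.

(** T i^p sends the wandering subspace of T i into the complement of the range of
    T i^(p+1), and the other factors preserve both subspaces. *)
Lemma prodT_orth s m x (i : J) : uniq s -> i \in s -> wandering1 (val i) x ->
  orth (iter_range (T (val i)) (m i).+1) ((prodT s m) x).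
Proof.
move=> + + Wx; elim: s => // j s IH /= /andP[js us]; rewrite big_cons inE /=.
have [eij _|ij /= si] := eqVneq i j.
  rewrite -{j}eij in js *.
  have : wandering1 (val i) ((prodT s m) x).
    apply: prodT_inv Wx => l ls y; apply: (doubly_invariant_wandering1 _).1.
    by rewrite (inj_eq val_inj); apply: contraNneq js => ->.
  by elim: (m i) => // p IHp /IHp; exact: (orth_iter_rangeS dotE).
apply: iter_inv (IH us si) => y.
apply: (doubly_invariant_orth dotE (isoT _) _).1.
by apply: doubly_invariant_iter_range; rewrite (inj_eq val_inj).
Qed.

(** On the unitary parts T j inverts its adjoint, so applying powers of the
    adjoints to x produces a preimage of x. *)
Lemma prodT_surj s m M x :
  (forall j : J, j \in s -> forall y, M y -> M (adj (val j) y)) ->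
  (forall j : J, j \in s -> M `<=` unitary_part (T (val j))) ->
  M x -> exists2 w, M w & (prodT s m) w = x.
Proof.
elim: s x => [|j s IH] x MT MU Mx; first by exists x; rewrite // big_nil.
have [My yE] : M (iter (m j) (adj (val j)) x) /\
    iter (m j) (T (val j)) (iter (m j) (adj (val j)) x) = x.
  elim: (m j) => // p [Mp pE]; split; first by apply: MT; rewrite ?mem_head.
  rewrite iterSr /= (unitary_part_adjKV dotE) //.
  by apply: MU Mp; rewrite mem_head.
have [||w Mw wE] := IH _ _ _ My.
- by move=> l ls; apply: MT; rewrite inE ls orbT.
- by move=> l ls; apply: MU; rewrite inE ls orbT.
by exists w => //; rewrite big_cons /= wE.
Qed.

Lemma closed_subspace_prodT s m M :
  closed_subspace M -> closed_subspace ((prodT s m) @` M).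
Proof.
move=> cM; elim: s => [|j s IH]; first by rewrite big_nil image_id.
rewrite big_cons -image_comp; elim: (m j) => [|p IHp].
  by rewrite (_ : iter 0 _ = id) // image_id.
rewrite (_ : iter p.+1 _ = T (val j) \o iter p (T (val j))) // -image_comp.
exact: (closed_subspace_image dotE).
Qed.

(** The vector z is obtained from q by applying, for each i in s, a power of the
    adjoint of T i and the projection onto the wandering subspace of T i, with the
    power chosen so that the result is not 0. By adjunction the inner product of q
    with the product of powers applied to z is the square of the norm of z. *)
Lemma prodT_detect s M q : uniq s -> closed_subspace M ->
  (forall j : J, j \in s -> doubly_invariant dot (T (val j)) M) ->
  (forall j : J, j \in s -> M `<=` shift_part dot (T (val j))) ->
  M q -> q != 0 ->
  exists m z, [/\ M z, forall j, j \in s -> wandering1 (val j) z &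
    dot ((prodT s m) z) q != 0].
Proof.
elim: s M q => [|i s IH] M q /=.
  move=> _ _ _ _ Mq q0; exists [ffun=> 0%N], q.
  by rewrite big_nil dnorm_eq0; split.
move=> /andP[iNs us] cM IM SM Mq q0.
have IMi := IM i (mem_head _ _).
have [p] := shift_part_wandering (SM i (mem_head _ _) _ Mq) q0.
set y := iter p _ q => y0.
have My : M y.
  exact: (iter_adjoint_on_doubly_invariant dotE (isoT _) p cM IMi Mq).1.
pose N := M `&` wandering1 (val i).
have Ny : N (wandering_proj (val i) y).
  by split; [exact: (wandering_proj_inv cM)|exact: wandering_proj_mem].
have iNj j : j \in s -> val i != val j.
  by move=> js; rewrite (inj_eq val_inj); apply: contraNneq iNs => ->.
have [|||m [z [[Mz Wz] zs zq]]] := IH N _ us _ _ _ Ny y0.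
- by apply: closed_subspaceI => //; exact: closed_subspace_wandering1.
- move=> j js; apply: doubly_invariantI; first by apply: IM; rewrite inE js orbT.
  exact: doubly_invariant_wandering1 (iNj _ js).
- move=> j js; apply: subset_trans (SM j _); first exact: subIsetl.
  by rewrite inE js orbT.
(* i is not in s, so the exponents of the other factors are unchanged. *)
pose m' : multi_index L := [ffun j => if j == i then p else m j].
exists m', z; split=> // [j|].
  by rewrite inE => /predU1P[->|] //; exact: zs.
rewrite big_cons /= ffunE eqxx (iter_adj_dot dotE (isoT _)) -/y.
have -> : prodT s m' = prodT s m.
  apply: eq_big_seq => j js; rewrite ffunE ifN //.
  by apply: contraNneq iNs => <-.
have Ww : wandering1 (val i) ((prodT s m) z).
  apply: prodT_inv Wz => j js x.
  exact: (doubly_invariant_wandering1 (iNj _ js)).1.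
move: zq; rewrite /wandering_proj dotBr (Ww (T (val i) _)) ?subr0 //.
by exists (adj (val i) y).
Qed.

End Powers.

(** The T i with i outside L preserve W_L and map the core onto itself; the
    multi-indices with constant value k show that the intersection lies in the
    range of T i^k for each such i. *)
Lemma wold_coreE L :
  \bigcap_(m in [set: multi_index (~: L)%SET]) (tpow T m @` wandering dot T L) =
  wold_core L.
Proof.
rewrite wanderingE; apply/seteqP; split=> [x h i _|x h m _].
  case: ifPn => iL.
    have [w Ww <-] := h [ffun=> 0%N] I.
    apply: prodT_inv (Ww i iL) => j _ y; apply: (doubly_invariant_wandering1 _).1.
    by apply: contraTneq iL => ->; have := valP j; rewrite inE.
  move=> k _; have [w _ <-] := h [ffun=> k] I.
  have iL' : i \in (~: L)%SET by rewrite inE.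
  have := prodT_range (s := enum {: {i : 'I_n | i \in (~: L)%SET}})
    [ffun=> k] w (i := exist _ i iL').
  by rewrite ffunE; apply; rewrite mem_enum.
have [j _|j _|w Cw wE] := prodT_surj
    (s := enum {: {i : 'I_n | i \in (~: L)%SET}}) m _ _ h.
- by apply: (doubly_invariant_wold_core _).2; have := valP j; rewrite inE.
- by move=> y /(_ (val j) I); rewrite ifN //; have := valP j; rewrite inE.
by exists w => // i iL; have := Cw i I; rewrite iL.
Qed.

Lemma wold_part_core_dsum L :
  orth_dsum dot (fun k : multi_index L => tpow T k @` wold_core L) (wold_part L).
Proof.
split.
- by move=> k; apply: closed_subspace_prodT; exact: closed_subspace_wold_core.
- have lt_orth (k k' : multi_index L) i : (k i < k' i)%N ->
      tpow T k @` wold_core L `<=` orth (tpow T k' @` wold_core L).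
    move=> ki _ [z Cz <-] _ [z' _ <-].
    have Wz : wandering1 (val i) z by have := Cz (val i) I; rewrite (valP i).
    apply: (prodT_orth (enum_uniq _) (mem_enum _ i) Wz).
    apply: (iter_range_le ki).
    by apply: prodT_range; rewrite mem_enum.
  move=> k k' kk'.
  have [i +] : exists i, k i != k' i.
    apply: contrapT => h; apply: kk'; apply/ffunP => i.
    apply/eqP/negPn/negP => hi.
    by apply: h; exists i.
  rewrite neq_ltn => /orP[/lt_orth //|/lt_orth h] x kx y ky.
  by apply: dotC0; exact: h.
apply: (span_eq dotE); first exact: closed_subspace_wold_part.
  move=> _ [k _ [z Cz <-]]; apply: prodT_inv (sub_wold_core Cz) => j _.
  exact: (doubly_invariant_wold_part _ _).1.
move=> q Pq Oq; apply/eqP/negPn/negP => q0.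
have [| |m [z [Pz Wz /eqP zq]]] :=
    prodT_detect (enum_uniq {: {i : 'I_n | i \in L}})
      (closed_subspace_wold_part L) _ _ Pq q0.
- by move=> j _; exact: doubly_invariant_wold_part.
- by move=> j _ x /(_ (val j) I); rewrite /wold_factor (valP j).
apply: zq; apply: dotC0; apply: Oq; exists m => //; exists z => // i _.
have := Pz i I; rewrite /wold_factor; case: ifP => // iL _.
by apply: (Wz (exist _ i iL)); rewrite mem_enum.
Qed.

End Multivariate.

(** * Twisted isometries *)

Section Twist.
Variables (R : realType) (H : completeNormedModType R[i]).
Variable dot : {dot H for (@Num.conj R[i])}.
Hypothesis dotE : hilbert_dot dot.
Implicit Types (x y z : H).

(** The adjoint takes the value 0 at y when no representing vector exists, but
    then y = A 0 = 0, which is represented by 0. *)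
Lemma unitary_adjoint_dot (A : {linear H -> H}) : unitary_on dot setT A ->
  forall x y, dot (A x) y = dot x (adjoint dot A y).
Proof.
move=> uA x y; have [_ _] := uA y I.
rewrite -/(adjoint dot A) /adjoint /adjoint_on.
case: xgetP => [z _ [_ ->] //|noadj /=].
rewrite linear0 => y0; case: (noadj 0); split=> // w _.
by rewrite -y0 !dot0r.
Qed.

Lemma unitary_adjointK (A : {linear H -> H}) : unitary_on dot setT A ->
  adjoint dot (adjoint dot A) = A.
Proof.
move=> uA; apply: adjoint_unique => x y.
by rewrite dotC -(unitary_adjoint_dot uA) -dotC.
Qed.

Lemma twist_adjoint n (U : 'I_n -> 'I_n -> {linear H -> H}) (i j : 'I_n) :
  (forall k l : 'I_n, (k < l)%N -> unitary_on dot setT (U k l)) ->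
  i != j -> adjoint dot (twist dot U i j) = twist dot U j i.
Proof.
move=> uU ij; rewrite /twist; case: (ltngtP i j) => // [lt_ji|/val_inj eij].
  by apply: unitary_adjointK; exact: uU.
by rewrite eij eqxx in ij.
Qed.

(** Both twisted relations have the form A T_i = T_i V A, with A = T_j, V = U_ji
    or A = T_j^*, V = U_ij, and the twist commutes with T_i. *)
Lemma twisted_doubly_invariant_iter_range n (T : 'I_n -> {linear H -> H})
    (i j : 'I_n) m :
  twisted_isometry dot T -> i != j ->
  doubly_invariant dot (T j) (iter_range (T i) m).
Proof.
move=> [U [uU _ _ tw]] ij; have ji : j != i by rewrite eq_sym.
have [TT T'T UT] := tw _ _ ji; have [_ _ UT'] := tw _ _ ij.
have adjU : adjoint dot (twist dot U j i) = twist dot U i j.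
  by apply: twist_adjoint => // k l; exact: uU.
split=> x.
  apply: (iter_range_comm (V := twist dot U j i)) => y; first exact/esym/(UT i).
  by rewrite [LHS]TT; exact/esym/(UT i).
apply: (iter_range_comm (V := twist dot U i j)) => y; first exact/esym/(UT' i).
by rewrite [LHS]T'T adjU; exact/esym/(UT' i).
Qed.

End Twist.

Theorem theorem4p3 (R : realType) (H : completeNormedModType R[i])
    (dot : {dot H for (@Num.conj R[i])}) (n : nat)
    (T : 'I_n -> {linear H -> H}) :
  hilbert_dot dot -> (1 < n)%N -> twisted_isometry dot T ->
  exists HL : {set 'I_n} -> set H,
    [/\ wold_decomposition dot T HL,
        forall L : {set 'I_n},
          orth_dsum dot
            (fun k : multi_index L =>
               tpow T k @`
                 \bigcap_(m in [set: multi_index (~: L)%SET])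
                   (tpow T m @` wandering dot T L))
            (HL L) &
        forall K : {set 'I_n} -> set H, wold_decomposition dot T K -> K = HL].
Proof.
move=> dotE _ tw; have [_ [_ _ isoT _]] := tw.
have dinvT i j m := twisted_doubly_invariant_iter_range m tw (i := i) (j := j).
exists (wold_part dot T); split; first exact: wold_partP.
  by move=> L; rewrite wold_coreE //; exact: wold_part_core_dsum.
exact: wold_part_unique.
Qed.
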